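(* Let $q$ be the morphism on the alphabet $\{0,1,\ldots,21\}$ and $\gamma$ the coding to $\{0,1\}$ defined by (letters in images separated by commas): $q(0)=0,1$; $q(1)=2,3$; $q(2)=4,5$; $q(3)=6,7$; $q(4)=8,9$; $q(5)=10,11$; $q(6)=12,7$; $q(7)=8,9$; $q(8)=13,14$; $q(9)=15,1$; $q(10)=2,16$; $q(11)=7,17$; $q(12)=6,4$; $q(13)=2,16$; $q(14)=18,19$; $q(15)=0,1$; $q(16)=6,7$; $q(17)=10,11$; $q(18)=20,9$; $q(19)=10,21$; $q(20)=13,14$; $q(21)=18,19$; $\gamma(i)=1$ for $i\in\{0,1,3,6,7,11,12,13,14,17,19,20\}$ and $\gamma(i)=0$ for $i\in\{2,4,5,8,9,10,15,16,18,21\}$. Then the infinite word $\gamma(q^\omega(0))=11010011000111001101001110001101000111010011000\cdots$ contains only three distinct squares: $0^2$, $1^2$, and $(10)^2$. It has total weight $44$.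
   Context: A square is a nonempty word $xx$; ''containing'' means as a factor. $q^\omega(0)$ is the infinite fixed point of $q$ starting with $0$. The weight of a morphism $h:\Sigma^*\to\Sigma^*$ is $\sum_{a\in\Sigma}|h(a)|$, and the weight of a $k$-automatic word is the weight of its defining $k$-uniform morphism (here $2\cdot 22=44$). *)

(* Defs.v *)
From mathcomp Require Import all_boot.
Set Implicit Arguments. Unset Strict Implicit. Unset Printing Implicit Defensive.

(* Alphabet {0,...,21} represented by nat; letters outside never occur. *)
Definition Sigma : seq nat := iota 0 22.

Definition q_images : seq (seq nat) :=
  [:: [:: 0; 1]; [:: 2; 3]; [:: 4; 5]; [:: 6; 7]; [:: 8; 9]; [:: 10; 11];
      [:: 12; 7]; [:: 8; 9]; [:: 13; 14]; [:: 15; 1]; [:: 2; 16]; [:: 7; 17];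
      [:: 6; 4]; [:: 2; 16]; [:: 18; 19]; [:: 0; 1]; [:: 6; 7]; [:: 10; 11];
      [:: 20; 9]; [:: 10; 21]; [:: 13; 14]; [:: 18; 19]].

Definition q (a : nat) : seq nat := nth [::] q_images a.

Definition qstar (w : seq nat) : seq nat := flatten (map q w).

Definition gamma (a : nat) : nat :=
  if a \in [:: 0; 1; 3; 6; 7; 11; 12; 13; 14; 17; 19; 20] then 1 else 0.

(* q^omega(0): its n-th letter is the n-th letter of q^(n+1)(0),
   a prefix of length 2^(n+1) > n of the fixed point (q(0) starts with 0). *)
Definition qomega (n : nat) : nat := nth 0 (iter n.+1 qstar [:: 0]) n.

Definition x (n : nat) : nat := gamma (qomega n).

Definition factor_of (w : nat -> nat) (u : seq nat) : Prop :=
  exists i, forall j, j < size u -> nth 0 u j = w (i + j).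

Definition weight (h : nat -> seq nat) : nat := \sum_(a <- Sigma) size (h a).

(* Main.v *)
Require Import Defs.
From mathcomp Require Import all_boot zify.

(** Call two letters equivalent when some power of [q] sends them to the same
    word; there are nine classes.  On classes, [q] is injective, and so close to
    being injective on first letters and on last letters that every square of
    even period [2p] in the class word comes from a square of period [p],
    whatever the parity of its position.  The class word determines the parity of
    the position of its factors of length 9, which excludes long odd periods, so
    it is square-free.  Finally, a factor of length 19 of the binary word
    determines the underlying factor of [q^omega(0)], so a binary square of
    period at least 19 would give a square in the class word. *)

(* Each class is named by its least element. *)
Definition merge (a : nat) : nat :=
  nth 0 [:: 0; 1; 2; 3; 4; 5; 6; 4; 8; 0; 1; 2; 3; 1; 14; 0; 3; 5; 4; 8; 8; 14] a.

(** Meant to include every length-two factor of [qomega]: the list holds the image of each letter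
    and is closed under taking the pair that straddles the images of two paired letters. *)
Definition letter_pairs : seq (nat * nat) :=
  [:: (0, 1); (1, 2); (2, 3); (2, 16); (3, 4); (4, 5); (4, 8); (5, 6); (6, 4);
      (6, 7); (7, 8); (7, 17); (7, 20); (8, 9); (9, 10); (9, 13); (10, 11);
      (10, 21); (11, 12); (12, 7); (13, 14); (14, 15); (15, 1); (16, 7);
      (16, 18); (17, 6); (18, 19); (19, 0); (20, 9); (21, 0)].

Definition q_letter (a b : nat) : nat := nth 0 (q a) b.

(** * The fixed point, letter by letter *)

Lemma all_SigmaP (P : pred nat) : all P Sigma -> forall a, a < 22 -> P a.
Proof. by move=> /allP h a ha; apply: h; rewrite mem_iota. Qed.

Lemma size_q a : a < 22 -> size (q a) = 2.
Proof. by move=> ha; apply/eqP; apply: (all_SigmaP (fun a => size (q a) == 2)) ha. Qed.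

Lemma q_lt22 a : a < 22 -> all (gtn 22) (q a).
Proof. exact: (all_SigmaP (fun a => all (gtn 22) (q a))). Qed.

Lemma qstar_lt22 s : all (gtn 22) s -> all (gtn 22) (qstar s).
Proof.
elim: s => //= a s IHs /andP[ha hs].
by rewrite /qstar /= all_cat q_lt22 //=; apply: IHs.
Qed.

Lemma size_qstar s : all (gtn 22) s -> size (qstar s) = (size s).*2.
Proof.
elim: s => //= a s IHs /andP[ha hs].
by rewrite /qstar /= size_cat size_q // doubleS; congr _.+2; apply: IHs.
Qed.

Lemma nth_qstar s n b : all (gtn 22) s -> n < size s -> b < 2 ->
  nth 0 (qstar s) (n.*2 + b) = q_letter (nth 0 s n) b.
Proof.
move=> hs hn hb; elim: s n hs hn => //= a s IHs n /andP[ha hs].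
rewrite /qstar /= nth_cat size_q //.
case: n => [|n] hn; first by rewrite hb.
by rewrite doubleS !addSn ltnNge /= !subSS subn0; apply: IHs.
Qed.

Lemma iter_qstar_lt22 s k : all (gtn 22) s -> all (gtn 22) (iter k qstar s).
Proof. by move=> hs; elim: k => //= k; apply: qstar_lt22. Qed.

Lemma size_iter_qstar s k : all (gtn 22) s -> size (iter k qstar s) = 2 ^ k * size s.
Proof.
move=> hs; elim: k => [|k IHk]; first by rewrite mul1n.
by rewrite iterS size_qstar ?iter_qstar_lt22 // IHk expnS -mul2n mulnA.
Qed.

(** As [q 0] starts with [0], each iterate is a prefix of the next: position [n] on both sides
    descends from position [n./2] one level lower. *)
Lemma nth_iter_qstar0 k n : n < 2 ^ k ->
  nth 0 (iter k.+1 qstar [:: 0]) n = nth 0 (iter k qstar [:: 0]) n.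
Proof.
elim: k n => [|k IHk] n hn; first by case: n hn.
have lt22 j : all (gtn 22) (iter j qstar [:: 0]) by apply: iter_qstar_lt22.
have sz j : size (iter j qstar [:: 0]) = 2 ^ j by rewrite size_iter_qstar ?muln1.
have hn2 : n./2 < 2 ^ k by rewrite expnS in hn; lia.
have en : n = (n./2).*2 + odd n by lia.
have ob : odd n < 2 by case: odd.
rewrite en [iter k.+2 _ _]iterS [iter k.+1 _ _ in RHS]iterS.
by rewrite !nth_qstar ?sz ?IHk // expnS; lia.
Qed.

Lemma qomegaE k n : n < 2 ^ k -> qomega n = nth 0 (iter k qstar [:: 0]) n.
Proof.
have mono j m d : m < 2 ^ j ->
    nth 0 (iter (j + d) qstar [:: 0]) m = nth 0 (iter j qstar [:: 0]) m.
  move=> hm; elim: d => [|d IHd]; first by rewrite addn0.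
  by rewrite addnS nth_iter_qstar0 // (leq_trans hm) // leq_pexp2l // leq_addr.
move=> hn; rewrite /qomega; have hn1 : n < 2 ^ n.+1 by rewrite ltnW // ltn_expl.
have [le_nk|/ltnW le_kn] := leqP n.+1 k.
  by rewrite -(subnKC le_nk) mono.
by rewrite -(subnKC le_kn) mono.
Qed.

Lemma qomega_lt22 n : qomega n < 22.
Proof.
have := iter_qstar_lt22 [:: 0] n.+1 isT => /all_nthP; apply.
by rewrite size_iter_qstar // muln1 ltnW // ltn_expl.
Qed.

(** Invariance of the infinite word under [q], in a form suited to induction on positions. *)
Lemma qomega_double n b : b < 2 -> qomega (n.*2 + b) = q_letter (qomega n) b.
Proof.
move=> hb; have hn : n < 2 ^ n.+1 by rewrite ltnW // ltn_expl.
rewrite (qomegaE n.+2); last by rewrite expnS; lia.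
by rewrite iterS nth_qstar ?iter_qstar_lt22 ?size_iter_qstar ?muln1.
Qed.

(** A pair at an odd position straddles the images of the pair at half that position; a pair at an
    even position is the image of a single letter. *)
Lemma qomega_pair n : (qomega n, qomega n.+1) \in letter_pairs.
Proof.
elim/ltn_ind: n => n IHn; rewrite -[n]odd_double_half addnC.
case: (boolP (odd n)) => on.
  have /IHn h : n./2 < n by lia.
  have -> : ((n./2).*2 + true).+1 = (n./2.+1).*2 + 0 by lia.
  rewrite !qomega_double //.
  by have /allP/(_ _ h) : all (fun ab : nat * nat =>
    (q_letter ab.1 1, q_letter ab.2 0) \in letter_pairs) letter_pairs by [].
rewrite -addnS !qomega_double //.
exact: (all_SigmaP (fun a => (q_letter a 0, q_letter a 1) \in letter_pairs)) (qomega_lt22 _).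
Qed.

(** * Enumeration of finite windows *)

Definition window (i l : nat) : seq nat := mkseq (fun j => qomega (i + j)) l.

Lemma nth_window i l j : j < l -> nth 0 (window i l) j = qomega (i + j).
Proof. exact: nth_mkseq. Qed.

Lemma map_window (f : nat -> nat) i l :
  map f (window i l) = mkseq (fun j => f (qomega (i + j))) l.
Proof. by rewrite /window /mkseq -map_comp. Qed.

Lemma qomega_block k n r : r < 2 ^ k.+1 ->
  qomega (2 ^ k * n + r) = nth 0 (iter k qstar [:: qomega n; qomega n.+1]) r.
Proof.
have lt22 : all (gtn 22) [:: qomega n; qomega n.+1] by rewrite /= !qomega_lt22.
elim: k r => [|k IHk] r hr.
  by rewrite mul1n; case: r hr => [|[]] //; rewrite ?addn0 ?addn1.
have ob : odd r < 2 by case: odd.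
have hr2 : r./2 < 2 ^ k.+1 by move: hr; rewrite expnS; lia.
have -> : 2 ^ k.+1 * n + r = (2 ^ k * n + r./2).*2 + odd r by rewrite expnS; lia.
rewrite qomega_double // IHk // [r in RHS](_ : r = (r./2).*2 + odd r); last by lia.
rewrite iterS nth_qstar ?iter_qstar_lt22 ?size_iter_qstar //.
by rewrite mulnC -expnS.
Qed.

(* All the windows of length [l <= 2 ^ k + 1], tagged with the parity of their
   position when [k > 0]. *)
Definition windows (k l : nat) : seq (bool * seq nat) :=
  [seq (odd r, take l (drop r (iter k qstar [:: ab.1; ab.2])))
     | ab <- letter_pairs, r <- iota 0 (2 ^ k)].

(** A window of length at most [2 ^ k + 1] that starts in one block of length [2 ^ k] ends in the
    next block at the latest, so a pair of ancestors suffices. For [k > 0] blocks have even length,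
    so [r] has the parity of [i]. *)
Lemma window_in k l i : 0 < k -> l <= (2 ^ k).+1 -> (odd i, window i l) \in windows k l.
Proof.
move=> k_gt0 hl; set n := i %/ 2 ^ k; set r := i %% 2 ^ k.
have hr : r < 2 ^ k by rewrite ltn_mod expn_gt0.
have ei : i = 2 ^ k * n + r by rewrite mulnC; apply: divn_eq.
apply/allpairsP; exists ((qomega n, qomega n.+1), r) => /=.
split; [exact: qomega_pair | by rewrite mem_iota |].
have lt22 : all (gtn 22) [:: qomega n; qomega n.+1] by rewrite /= !qomega_lt22.
have sz : size (iter k qstar [:: qomega n; qomega n.+1]) = 2 ^ k.+1.
  by rewrite size_iter_qstar // mulnC -expnS.
congr pair; first by rewrite ei oddD oddM oddX orbF eqn0Ngt k_gt0.
have szl : size (take l (drop r (iter k qstar [:: qomega n; qomega n.+1]))) = l.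
  by rewrite size_take size_drop sz expnS; case: ltnP; lia.
apply: (@eq_from_nth _ 0); first by rewrite size_mkseq szl.
move=> j; rewrite size_mkseq => hj.
rewrite nth_window // nth_take // nth_drop ei -addnA qomega_block // expnS; lia.
Qed.

(** * Squares in the class word *)

Definition square_at (f : nat -> nat) (p i : nat) : Prop :=
  forall t, t < p -> f (qomega (i + t)) = f (qomega (i + p + t)).

Definition square_prefix (p : nat) (s : seq nat) : bool :=
  take p s == take p (drop p s).

Lemma square_at_prefix f p i l : p + p <= l -> square_at f p i ->
  square_prefix p (map f (window i l)).
Proof.
move=> hp sq; apply/eqP; rewrite map_window.
have szl : size (mkseq (fun j => f (qomega (i + j))) l) = l by rewrite size_mkseq.
have sz1 : size (take p (mkseq (fun j => f (qomega (i + j))) l)) = p.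
  by rewrite size_takel // szl; lia.
apply: (@eq_from_nth _ 0).
  by rewrite sz1 size_takel // size_drop szl; lia.
rewrite sz1 => t ht; rewrite !nth_take // nth_drop !nth_mkseq; try lia.
by rewrite sq // addnA.
Qed.

Lemma merge_q_inj a b : a < 22 -> b < 22 ->
  merge (q_letter a 0) = merge (q_letter b 0) ->
  merge (q_letter a 1) = merge (q_letter b 1) -> merge a = merge b.
Proof.
move=> ha hb e0 e1; apply/eqP.
have := all_SigmaP _ (_ : all (fun a => all (fun b =>
  (merge (q_letter a 0) == merge (q_letter b 0)) ==>
  (merge (q_letter a 1) == merge (q_letter b 1)) ==> (merge a == merge b)) Sigma) Sigma).
move/(_ isT _ ha)/(all_SigmaP (fun b => _))/(_ _ hb).
by rewrite e0 e1 !eqxx.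
Qed.

(* [b] is the ancestor of the two letters around the centre of a square at an odd
   position. *)
Lemma merge_q_straddle a b d : a < 22 -> b < 22 -> d < 22 ->
  merge (q_letter a 1) = merge (q_letter b 1) ->
  merge (q_letter b 0) = merge (q_letter d 0) ->
  merge a = merge b \/ merge b = merge d.
Proof.
move=> ha hb hd e1 e0.
suff: (merge a == merge b) || (merge b == merge d) by case/orP=> /eqP ?; [left | right].
have := all_SigmaP _ (_ : all (fun b =>
  all (fun a => (merge (q_letter a 1) == merge (q_letter b 1)) ==> (merge a == merge b)) Sigma
  || all (fun d => (merge (q_letter b 0) == merge (q_letter d 0)) ==> (merge b == merge d)) Sigma)
  Sigma).
move=> /(_ isT _ hb)/orP[] /all_SigmaP.
  by move/(_ _ ha); rewrite e1 eqxx /= => ->.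
by move/(_ _ hd); rewrite e0 eqxx /= => ->; rewrite orbT.
Qed.

(** Images lying wholly inside the first half of the square are matched with those [p] letters
    further on, and [merge_q_inj] lifts the match to ancestors. For even [i] this covers everything;
    for odd [i] the half images at the two ends and the image across the centre remain. *)
Lemma merge_halve p i : square_at merge p.*2 i -> exists j, square_at merge p j.
Proof.
move=> sq; set m := i./2.
have sqb n b : b < 2 -> i <= n.*2 + b < i + p.*2 ->
    merge (q_letter (qomega n) b) = merge (q_letter (qomega (n + p)) b).
  move=> hb hn; rewrite -!qomega_double //.
  have := sq (n.*2 + b - i); rewrite (_ : i + (_ - i) = n.*2 + b); last by lia.
  rewrite (_ : i + p.*2 + (_ - i) = (n + p).*2 + b); last by lia.
  by apply; lia.
have inner n : i <= n.*2 -> n.*2.+1 < i + p.*2 ->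
    merge (qomega n) = merge (qomega (n + p)).
  move=> h1 h2; apply: merge_q_inj; rewrite ?qomega_lt22 //; apply: sqb => //; lia.
case: (boolP (odd i)) => oi; last first.
  by exists m => t ht; rewrite addnAC; apply: inner; lia.
case: (posnP p) => [-> | p_gt0]; first by exists 0.
(* The outer ancestors are at [m] and [m + p + p], the central one at [m + p]. Whichever of them
   matches the central one completes a square, at [m] or at [m.+1]. *)
have [||e|e] := merge_q_straddle (qomega m) (qomega (m + p)) (qomega (m + p + p))
  (qomega_lt22 _) (qomega_lt22 _) (qomega_lt22 _).
- by apply: sqb => //; lia.
- by apply: sqb => //; lia.
- exists m => -[|t] ht; first by rewrite !addn0.
  by rewrite addnAC; apply: inner; lia.
- exists m.+1 => t ht; rewrite addnAC.
  case: (ltnP t.+1 p) => ht1; first by apply: inner; lia.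
  by rewrite (_ : m.+1 + t = m + p) //; lia.
Qed.

(* Removing duplicates first keeps the quadratic comparison small. *)
Definition determines (T A B : eqType) (f : T -> A) (g : T -> B) (s : seq T) : bool :=
  let fgs := undup [seq (f u, g u) | u <- s] in
  all (fun a => all (fun b => (a.1 == b.1) ==> (a.2 == b.2)) fgs) fgs.

Lemma determinesP (T A B : eqType) (f : T -> A) (g : T -> B) (s : seq T) :
  determines T A B f g s -> {in s &, forall u v, f u = f v -> g u = g v}.
Proof.
move=> /allP fg_s u v su sv e; apply/eqP.
have fgs w : w \in s -> (f w, g w) \in undup [seq (f u, g u) | u <- s].
  by move=> sw; rewrite mem_undup; apply/mapP; exists w.
by have /allP/(_ _ (fgs v sv)) := fg_s _ (fgs u su); rewrite /= e eqxx.
Qed.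

Lemma merge_parity i j :
  map merge (window i 9) = map merge (window j 9) -> odd i = odd j.
Proof.
(* Level 3 is the least one that allows length [9 = 2 ^ 3 + 1]. *)
have /determinesP h : determines _ _ _ (fun u => map merge u.2) fst (windows 3 9).
  by vm_compute.
exact: h (window_in 3 9 i isT isT) (window_in 3 9 j isT isT).
Qed.

Lemma merge_no_short_odd_square p i : odd p -> p < 9 -> ~ square_at merge p i.
Proof.
move=> op hp sq.
(* Length 16 holds a whole square of any period below 9, and [16 <= 2 ^ 4 + 1]. *)
have /allP : all (fun u => all (fun p => odd p ==> ~~ square_prefix p (map merge u.2))
  (iota 0 9)) (windows 4 16) by vm_compute.
have win : (odd i, window i 16) \in windows 4 16 by apply: window_in.
have p_in : p \in iota 0 9 by rewrite mem_iota.
move=> /(_ _ win)/allP/(_ _ p_in)/implyP/(_ op)/negP; apply.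
by apply: square_at_prefix sq; lia.
Qed.

Lemma merge_squarefree p i : 0 < p -> ~ square_at merge p i.
Proof.
elim/ltn_ind: p i => p IHp i p_gt0 sq.
case: (boolP (odd p)) => op; last first.
  have ep : p = p./2.*2 by lia.
  by rewrite ep in sq; have [j] := merge_halve _ _ sq; apply: IHp; lia.
case: (ltnP p 9) => hp; first exact: merge_no_short_odd_square sq.
(* The two halves begin with the same 9 classes, but an odd period puts them at positions of
   opposite parity. *)
have : odd i = odd (i + p).
  apply: merge_parity; rewrite !map_window; apply/eq_in_map => t.
  by rewrite mem_iota => /= ht; apply: sq; lia.
by rewrite oddD op; case: odd.
Qed.

(** * Squares in the binary word *)

Lemma gamma_window_inj i j :
  map gamma (window i 19) = map gamma (window j 19) -> window i 19 = window j 19.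
Proof.
have /determinesP h : determines _ _ _ (fun u => map gamma u.2) snd (windows 5 19).
  by vm_compute.
exact: h (window_in 5 19 i isT isT) (window_in 5 19 j isT isT).
Qed.

Lemma gamma_square_short p i : 0 < p -> square_at gamma p i -> p < 19.
Proof.
move=> p_gt0 sq; rewrite ltnNge; apply/negP => hp.
apply: (merge_squarefree p i p_gt0) => t ht; congr merge.
(* This offset gives a window of length 19 that contains position [i + t] and stays inside the first
   half of the square. *)
set s := minn t (p - 19).
have hts : t - s < 19 by rewrite /s; lia.
have : window (i + s) 19 = window (i + p + s) 19.
  apply: gamma_window_inj; rewrite !map_window; apply/eq_in_map => j.
  by rewrite mem_iota /= -!addnA => hj; rewrite addnA -addnA sq ?addnA //; lia.
move/(congr1 (fun u => nth 0 u (t - s))); rewrite !nth_window //.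
by rewrite -!addnA subnKC // /s geq_minl.
Qed.

Lemma gamma_short_squares p i : 0 < p < 19 -> square_at gamma p i ->
  map gamma (window i p) \in [:: [:: 0]; [:: 1]; [:: 1; 0]].
Proof.
move=> /andP[p_gt0 hp] sq.
(* Periods are at most 18, so 36 letters suffice; [2 ^ 5 + 1 < 36] forces level 6. *)
have /allP : all (fun u => let s := map gamma u.2 in
  all (fun p => square_prefix p s ==> (take p s \in [:: [:: 0]; [:: 1]; [:: 1; 0]]))
  (iota 1 18)) (windows 6 36) by vm_compute.
have win : (odd i, window i 36) \in windows 6 36 by apply: window_in.
have p_in : p \in iota 1 18 by rewrite mem_iota p_gt0.
have sqp : square_prefix p (map gamma (window i 36)) by apply: square_at_prefix sq; lia.
move=> /(_ _ win)/allP/(_ _ p_in)/implyP/(_ sqp).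
by rewrite !map_window /mkseq -map_take take_iota (_ : minn p 36 = p) //; lia.
Qed.

Lemma factor_squareP u : factor_of x (u ++ u) <->
  exists i, square_at gamma (size u) i /\ u = map gamma (window i (size u)).
Proof.
split=> [[i h]|[i [sq eu]]]; exists i.
  have h1 t : t < size u -> nth 0 u t = x (i + t).
    by move=> ht; rewrite -h ?nth_cat ?ht // size_cat; lia.
  split=> [t ht|].
    rewrite -/(x _) -h1 // -addnA -/(x _) -h; last by rewrite size_cat; lia.
    by rewrite nth_cat ltnNge leq_addr /= addKn.
  apply: (@eq_from_nth _ 0) => [|t ht]; first by rewrite size_map size_mkseq.
  by rewrite map_window nth_mkseq // h1.
have h1 t : t < size u -> nth 0 u t = x (i + t).
  by move=> ht; rewrite eu map_window nth_mkseq.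
move=> j; rewrite size_cat nth_cat => hj.
case: (ltnP j (size u)) => hju; first exact: h1.
have hs : j - size u < size u by lia.
by rewrite h1 // /x sq // -addnA subnKC.
Qed.

Theorem theorem6 :
  (forall u : seq nat, u <> [::] ->
     (factor_of x (u ++ u) <-> u \in [:: [:: 0]; [:: 1]; [:: 1; 0]]))
  /\ weight q = 44.
Proof.
split; last by rewrite /weight unlock.
move=> u u_neq0; split=> [/factor_squareP[i [sq eu]]|].
  have u_gt0 : 0 < size u by rewrite lt0n size_eq0; apply/eqP.
  by rewrite eu gamma_short_squares // u_gt0 (gamma_square_short _ _ u_gt0 sq).
(* The word starts with [110100]: [00] occurs at 4, [11] at 0 and [1010] at 1. *)
rewrite !inE => /or3P[] /eqP->; [exists 4|exists 0|exists 1];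
  by do 4?case.
Qed.
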